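(* Let $\mathcal{A}$ be a sign pattern of order $n$, and suppose $A\in\mathcal{A}$ is a nilpotent matrix that allows a full-rank Jacobian. Let $u\neq v$ be vertices such that $(u,v)$ is an arc of $D(\mathcal{A})$ lying on some composite $n$-cycle of $D(\mathcal{A})$, and such that $D(\mathcal{A})$ has a loop at $u$. Suppose that (i) every (simple) cycle of $D(\mathcal{A})$ that contains the vertex $u$ also contains the loop $(u,u)$ or the arc $(u,v)$; and (ii) the sum of the weights in $A$ of the composite $n$-cycles of $A$ that use the arc $(u,v)$ is nonzero. If $\mathcal{B}$ is a signed triangle extension of $\mathcal{A}$ at $(u,v)$, then every superpattern of $\mathcal{B}$ is spectrally arbitrary.
   Context: A sign pattern of order $n$ is an $n\times n$ matrix $\mathcal{A}=[\mathcal{A}_{ij}]$ with entries in $\{0,+,-\}$; a real matrix $A=[a_{ij}]$ has pattern $\mathcal{A}$ (written $A\in\mathcal{A}$) if $a_{ij}=0$ when $\mathcal{A}_{ij}=0$, $a_{ij}>0$ when $\mathcal{A}_{ij}=+$, and $a_{ij}<0$ when $\mathcal{A}_{ij}=-$. The digraph $D(\mathcal{A})$ has vertex set $\{1,\dots,n\}$ and an arc $(i,j)$ exactly when $\mathcal{A}_{ij}\neq 0$ (an arc $(i,i)$ is a loop). A (simple) $k$-cycle of $A$ is a nonzero product $a_{i_1i_2}a_{i_2i_3}\cdots a_{i_ki_1}$ with distinct indices $i_1,\dots,i_k$, corresponding to a cycle of the digraph; its weight is this product. A composite $k$-cycle is a product of vertex-disjoint simple cycles covering exactly $k$ vertices;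 its weight is the product of the weights of its simple cycles. $A$ allows a full-rank Jacobian: if $A$ has $m$ nonzero entries in positions $(i_1,j_1),\dots,(i_m,j_m)$, let $X$ be the matrix obtained from $A$ by replacing the entry in position $(i_k,j_k)$ by an indeterminate $x_k$, write the characteristic polynomial of $X$ as $z^n+f_1z^{n-1}+\cdots+f_n$ with $f_i$ polynomials in $x_1,\dots,x_m$, and let $J$ be the $n\times m$ matrix $J_{ij}=\partial f_i/\partial x_j$; $A$ allows a full-rank Jacobian if $J$ evaluated at $x_k=a_{i_kj_k}$ ($k=1,\dots,m$) has rank $n$. A pattern $\mathcal{A}'$ of order $n$ is spectrally arbitrary if for every monic real polynomial $p$ of degree $n$ there is a real matrix $A'\in\mathcal{A}'$ with characteristic polynomial $p$. A pattern $\mathcal{C}$ is a superpattern of $\mathcal{B}$ if $\mathcal{B}_{ij}\neq 0$ implies $\mathcal{C}_{ij}=\mathcal{B}_{ij}$. Triangle extension: if $G$ is a digraph with an arc $(u,v)$, $u\neq v$, and a loop at $u$, the triangle extension of $G$ at $(u,v)$ is the digraph $H$ obtained from $G$ by adding a new vertex $w$, deleting the loop at $u$, adding a loop at $w$, and adding arcs $(u,w)$ and $(w,v)$. A pattern $\mathcal{B}$ of order $n+1$ is a triangle extension of $\mathcal{A}$ at $(u,v)$ if $D(\mathcal{B})$ is the triangle extension of $D(\mathcal{A})$ at $(u,v)$ (the entries of $\mathcal{B}$ on arcs inherited from $D(\mathcal{A})$ being those of $\mathcal{A}$, and the loop at $w$ carrying the entry of the loop at $u$). For sign patterns, $\mathcal{B}$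 is a signed triangle extension if in addition $\operatorname{sgn}(\mathcal{B}_{u,w})\operatorname{sgn}(\mathcal{B}_{w,v})=\operatorname{sgn}(\mathcal{A}_{u,u})\operatorname{sgn}(\mathcal{A}_{u,v})$.
   Formalization: In (ii) each composite n-cycle's weight is taken with the sign (-1)^(number of its simple cycles), its contribution to the characteristic polynomial; with unsigned weights the claim fails, e.g. for A=[[1,1,0],[-1,0,1],[1,0,-1]], (u,v)=(1,2). *)

(* Defs.v *)
From HB Require Import structures.
From mathcomp Require Import all_boot all_order all_fingroup all_algebra.
From mathcomp Require Import reals.
From mathcomp.multinomials Require Import mpoly.

Set Implicit Arguments.
Unset Strict Implicit.
Unset Printing Implicit Defensive.

Import Order.TTheory GRing.Theory Num.Theory.
Local Open Scope ring_scope.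

Inductive sign := SZero | SPos | SNeg.

Definition int_of_sign (s : sign) : int :=
  match s with SZero => 0 | SPos => 1 | SNeg => -1 end.

Definition sign_of_int (z : int) : sign :=
  if z == 0 then SZero else if 0 < z then SPos else SNeg.

Lemma int_of_signK : cancel int_of_sign sign_of_int.
Proof. by case. Qed.

HB.instance Definition _ := Countable.copy sign (can_type int_of_signK).

Definition sign_pattern (n : nat) := 'M[sign]_n.

Definition has_sign (R : realType) (s : sign) (x : R) : Prop :=
  match s with SZero => x = 0 | SPos => 0 < x | SNeg => x < 0 end.

Definition has_pattern (R : realType) n (P : sign_pattern n) (A : 'M[R]_n) :=
  forall i j, has_sign (P i j) (A i j).

Definition digraph n (P : sign_pattern n) : rel 'I_n :=
  fun i j => P i j != SZero.

Definition mx_digraph (R : realType) n (A : 'M[R]_n) : rel 'I_n :=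
  fun i j => A i j != 0.

(* A simple cycle is represented by its set of arcs, so that cyclic rotations
   of the sequence of vertices are identified. *)
Definition arcs_of n (p : seq 'I_n) : {set 'I_n * 'I_n} :=
  [set (i, next p i) | i in p].

Definition simple_cycle n (G : rel 'I_n) (C : {set 'I_n * 'I_n}) : bool :=
  [exists k : 'I_n, exists p : k.+1.-tuple 'I_n,
     ucycleb G p && (C == arcs_of p)].

Definition cycle_vertices n (C : {set 'I_n * 'I_n}) : {set 'I_n} :=
  [set a.1 | a in C].

Definition composite_cycle n (G : rel 'I_n) (k : nat)
    (S : {set {set 'I_n * 'I_n}}) : bool :=
  [&& [forall C in S, simple_cycle G C],
      [forall C1 in S, forall C2 in S,
         (C1 != C2) ==> [disjoint cycle_vertices C1 & cycle_vertices C2]]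
    & #|\bigcup_(C in S) cycle_vertices C| == k].

Definition uses_arc n (S : {set {set 'I_n * 'I_n}}) (a : 'I_n * 'I_n) : bool :=
  [exists C in S, a \in C].

Definition cycle_weight (R : realType) n (A : 'M[R]_n)
    (C : {set 'I_n * 'I_n}) : R :=
  \prod_(a in C) A a.1 a.2.

Definition composite_weight (R : realType) n (A : 'M[R]_n)
    (S : {set {set 'I_n * 'I_n}}) : R :=
  \prod_(C in S) cycle_weight A C.

(* The contribution of a composite k-cycle to the coefficient of z^(n-k) of
   det(zI - A): its weight with the sign (-1)^(number of simple cycles).
   The sign is needed: for A = [1 1 0; -1 0 1; 1 0 -1] and (u,v) = (1,2) the two
   composite 3-cycles through (u,v) have plain weights 1 and 1, but their
   contributions to det A cancel, and the signed triangle extension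
   [0 + 0 +; - 0 + 0; + 0 - 0; 0 + 0 +] does not realize z^4 + 1. *)
Definition signed_composite_weight (R : realType) n (A : 'M[R]_n)
    (S : {set {set 'I_n * 'I_n}}) : R :=
  (-1) ^+ #|S| * composite_weight A S.

Definition nilpotent_mx (R : realType) n (A : 'M[R]_n) : Prop :=
  exists k : nat, A ^+ k = 0.

Definition nz_pos (R : realType) n (A : 'M[R]_n) : {set 'I_n * 'I_n} :=
  [set a | A a.1 a.2 != 0].

Definition nz_entry (R : realType) n (A : 'M[R]_n) (k : 'I_#|nz_pos A|) : R :=
  A (enum_val k).1 (enum_val k).2.

Definition indet_mx (R : realType) n (A : 'M[R]_n) :
    'M[{mpoly R[#|nz_pos A|]}]_n :=
  \matrix_(i, j) \sum_(k | enum_val k == (i, j)) 'X_k.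

Definition jacobian_mx (R : realType) n (A : 'M[R]_n) :
    'M[R]_(n, #|nz_pos A|) :=
  \matrix_(i, k)
    ((char_poly (indet_mx A))`_(n - i.+1))^`M(k).@[nz_entry (A := A)].

Definition full_rank_jacobian (R : realType) n (A : 'M[R]_n) : Prop :=
  \rank (jacobian_mx A) = n.

Definition spectrally_arbitrary (R : realType) n (P : sign_pattern n) : Prop :=
  forall p : {poly R}, p \is monic -> size p = n.+1 ->
  exists2 A : 'M[R]_n, has_pattern P A & char_poly A = p.

Definition superpattern n (B C : sign_pattern n) : Prop :=
  forall i j, B i j != SZero -> C i j = B i j.

(* Vertex i of the given digraph becomes lift ord_max i (with the same value);
   the new vertex w is ord_max. *)
Definition triangle_ext_digraph n (G : rel 'I_n) (u v : 'I_n) : rel 'I_n.+1 :=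
  fun x y =>
    match unlift ord_max x, unlift ord_max y with
    | Some i, Some j => G i j && ((i, j) != (u, u))
    | Some i, None => i == u
    | None, Some j => j == v
    | None, None => true
    end.

Definition triangle_extension n (A : sign_pattern n) (u v : 'I_n)
    (B : sign_pattern n.+1) : Prop :=
  [/\ [/\ u != v, digraph A u v & digraph A u u],
      digraph B =2 triangle_ext_digraph (digraph A) u v,
      forall i j, digraph A i j -> (i, j) != (u, u) ->
        B (lift ord_max i) (lift ord_max j) = A i j
    & B ord_max ord_max = A u u].

Definition signed_triangle_extension n (A : sign_pattern n) (u v : 'I_n)
    (B : sign_pattern n.+1) : Prop :=
  triangle_extension A u v B /\
  int_of_sign (B (lift ord_max u) ord_max) *
    int_of_sign (B ord_max (lift ord_max v)) =
  int_of_sign (A u u) * int_of_sign (A u v).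

(* Main.v *)
Require Import Defs.
From mathcomp Require Import all_boot all_order all_fingroup all_algebra.
From mathcomp Require Import reals ring lra zify.
From mathcomp.multinomials Require Import mpoly.

Set Implicit Arguments.
Unset Strict Implicit.
Unset Printing Implicit Defensive.

Import Order.TTheory GRing.Theory Num.Theory.
Local Open Scope ring_scope.

(** Write [Q] for the (u,v) cofactor of [z - M].  By (i), expanding [det (z - M)]
    along row [u] leaves only the columns [u] and [v], so the matrix [M'] obtained
    from [M] by the triangle extension with new entries [c] (at (u,w)) and [e]
    (at (w,v)) satisfies [det (z - M') = z det (z - M) + (M_uu M_uv - c e) Q].
    At [M = A] with [c e = A_uu A_uv] this gives a nilpotent [B] with the extended
    pattern; moving [M] in the pattern of [A] and [c] freely, the derivative of
    the characteristic polynomial at [B] reaches [z D + k Q] for every [k] and every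
    [D] of degree less than [n], because the Jacobian of [A] has full rank.  By (ii),
    [Q] does not vanish at 0, so the Jacobian of [B] has full rank too, and the
    nilpotent-Jacobian method applies to [B]. *)

(** * Derivations and the derivative of the characteristic polynomial *)

Section Derivation.

Variables (S T : comNzRingType) (f : {rmorphism S -> T}) (d : {additive S -> T}).
Hypothesis dM : forall x y, d (x * y) = f x * d y + d x * f y.

Lemma derivation1 : d 1 = 0.
Proof.
have := dM 1 1; rewrite !mulr1 rmorph1 mulr1 mul1r => h.
by apply: (@addrI _ (d 1)); rewrite -h addr0.
Qed.

Lemma derivation_prod (I : eqType) (r : seq I) (g : I -> S) : uniq r ->
  d (\prod_(i <- r) g i) =
  \sum_(i <- r) \prod_(j <- r) (if j == i then d (g j) else f (g j)).
Proof.
elim: r => [|i r IH] /=; first by rewrite !big_nil derivation1.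
case/andP=> ir ur; rewrite !big_cons dM IH // eqxx addrC; congr (_ + _).
  rewrite rmorph_prod; congr (_ * _); apply: eq_big_seq => j jr.
  by case: eqP => // ji; rewrite -ji jr in ir.
rewrite mulr_sumr; apply: eq_big_seq => j jr; rewrite big_cons.
by case: eqP => // ij; rewrite ij jr in ir.
Qed.

(** Jacobi's formula. The product rule turns [d] of the Leibniz expansion into a sum of
    determinants, the i-th of which has only row i differentiated; expanding along that row leaves
    the cofactors. *)
Lemma derivation_det n (N : 'M[S]_n) :
  d (\det N) = \sum_i \sum_j d (N i j) * cofactor (map_mx f N) i j.
Proof.
pose Nd i := \matrix_(k, l) (if k == i then d (N k l) else f (N k l)).
transitivity (\sum_i \det (Nd i)).
  rewrite raddf_sum exchange_big /=; apply: eq_bigr => s _.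
  have -> : d ((-1) ^+ s * \prod_i N i (s i)) = (-1) ^+ s * d (\prod_i N i (s i)).
    by case: (odd_perm s); rewrite ?expr1 ?expr0 ?mulN1r ?mul1r ?raddfN.
  rewrite derivation_prod ?index_enum_uniq // mulr_sumr.
  by apply: eq_bigr => i _; congr (_ * _); apply: eq_bigr => j _; rewrite mxE.
apply: eq_bigr => i _; rewrite (expand_det_row _ i); apply: eq_bigr => j _.
rewrite mxE eqxx; congr (_ * _); rewrite /cofactor; congr (_ * \det _).
by apply/matrixP => k l; rewrite !mxE eq_sym (negPf (neq_lift _ _)).
Qed.

End Derivation.

(** The directional derivative of [char_poly] at [M] along [V], in the form given by Jacobi's
    formula; the minus sign comes from z - M. *)
Definition dchar_poly (T : comNzRingType) n (M V : 'M[T]_n) : {poly T} :=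
  \sum_i \sum_j - (V i j)%:P * cofactor (char_poly_mx M) i j.

(** Applied coefficientwise, [d] is again a derivation on polynomials, and it kills the
    indeterminate, so [derivation_det] applies to z - M. The pair ([f], [d]) will be the value and
    linear coefficient of a curve, or the value and a partial derivative at a point. *)
Lemma derivation_char_poly (S T : comNzRingType) (f : {rmorphism S -> T})
    (d : {additive S -> T}) n (M : 'M[S]_n) k :
  (forall x y, d (x * y) = f x * d y + d x * f y) ->
  d (char_poly M)`_k = (dchar_poly (map_mx f M) (map_mx d M))`_k.
Proof.
move=> dM.
have dpM p q : map_poly d (p * q) = map_poly f p * map_poly d q + map_poly d p * map_poly f q.
  apply/polyP => l; rewrite coef_map coefM raddf_sum coefD !coefM -big_split.
  by apply: eq_bigr => i _; rewrite dM !coef_map.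
have -> : d (char_poly M)`_k = (map_poly d (char_poly M))`_k by rewrite coef_map.
congr (nth _ (polyseq _) k).
have -> : map_poly d (char_poly M) = \sum_i \sum_j map_poly d (char_poly_mx M i j)
    * cofactor (map_mx (map_poly f) (char_poly_mx M)) i j.
  exact (@derivation_det {poly S} {poly T} (map_poly f) (map_poly d) dpM n (char_poly_mx M)).
apply: eq_bigr => i _; apply: eq_bigr => j _; rewrite map_char_poly_mx.
congr (_ * _); apply/polyP => l.
rewrite coef_map !mxE coefB raddfB coefMn coefX coefN coefC [in RHS]coefC /=.
rewrite raddfMn /=.
have -> : d (l == 1)%:R = 0 by case: (l == _); rewrite ?raddf0 ?(derivation1 dM).
by rewrite mul0rn sub0r; case: (l == _); rewrite ?raddf0.
Qed.

Lemma dchar_poly_sum (T : comNzRingType) n (M : 'M[T]_n) (I : finType)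
    (c : I -> T) (V : I -> 'M[T]_n) :
  dchar_poly M (\sum_k c k *: V k) = \sum_k (c k)%:P * dchar_poly M (V k).
Proof.
rewrite /dchar_poly; under [RHS]eq_bigr do rewrite mulr_sumr.
rewrite [RHS]exchange_big /=; apply: eq_bigr => i _.
under [RHS]eq_bigr do rewrite mulr_sumr.
rewrite [RHS]exchange_big /=; apply: eq_bigr => j _.
rewrite summxE raddf_sum /= mulNr mulr_suml -sumrN; apply: eq_bigr => k _.
by rewrite mxE polyCM; ring.
Qed.

Lemma meval_mderivXU (T : comNzRingType) m (a : 'I_m -> T) j k :
  ('X_j)^`M(k).@[a] = (j == k)%:R.
Proof.
rewrite mderivX mnm1E mevalZ; case: eqP => [->|_]; last by rewrite mul0r.
rewrite (_ : (U_(k) - U_(k))%MM = 0%MM) ?mpolyX0 ?meval1 ?mulr1 //.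
by apply/mnmP => i; rewrite mnmBE subnn mnm0E.
Qed.

(** A matrix over [{poly T}] is read as a curve of matrices: its coefficients of degree 0 and 1 are
    the base point and the velocity. *)
Lemma dchar_poly_curve (T : comNzRingType) n (M : 'M[{poly T}]_n) k :
  (char_poly M)`_k`_1 =
  (dchar_poly (map_mx (coefp 0) M) (map_mx (coefp 1) M))`_k.
Proof.
rewrite -(derivation_char_poly (f := coefp 0)) // => p q /=.
by rewrite coefM !big_ord_recl big_ord0 addr0.
Qed.

Lemma dchar_poly_mpoly (T : comNzRingType) m n (M : 'M[{mpoly T[m]}]_n)
    (a : 'I_m -> T) j k :
  ((char_poly M)`_k)^`M(j).@[a] =
  (dchar_poly (map_mx (meval a) M) (map_mx (meval a \o mderiv j) M))`_k.
Proof.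
rewrite -(derivation_char_poly (d := meval a \o mderiv j)) // => p q /=.
by rewrite mderivM mevalD !mevalM addrC.
Qed.

(** Column k of the Jacobian is the derivative of the coefficients in the direction of the k-th
    nonzero position of [A]. Full row rank provides a right inverse, which produces a combination of
    these directions for every target. *)
Lemma full_rank_jacobian_onto (R : realType) n (A : 'M[R]_n) (q : nat -> R) :
  full_rank_jacobian A ->
  exists2 V : 'M[R]_n, forall i j, A i j = 0 -> V i j = 0 &
    forall i, (i < n)%N -> (dchar_poly A V)`_i = q i.
Proof.
move=> rkJ; set J := jacobian_mx A.
have Jfree : row_free J by rewrite /row_free rkJ.
(* Row i of the Jacobian belongs to the coefficient of z^(n-i-1), so the target is listed in
   reverse. *)
pose y : 'cV[R]_n := \col_i q (n - i.+1)%N.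
pose x := pinvmx J *m y.
have Jx : J *m x = y by rewrite mulmxA mulmxVp // mul1mx.
pose D (k : 'I_#|nz_pos A|) : 'M[R]_n := delta_mx (enum_val k).1 (enum_val k).2.
have DE k : map_mx (meval (nz_entry (A := A)) \o mderiv k) (indet_mx A) = D k.
  apply/matrixP => i j; rewrite !mxE /= (raddf_sum (mderiv k)) raddf_sum /=.
  under eq_bigr do rewrite meval_mderivXU.
  rewrite -[(i == _) && _]/((i, j) == ((enum_val k).1, (enum_val k).2)).
  rewrite -surjective_pairing eq_sym.
  case: eqP => kE.
    rewrite (bigD1 k) ?kE //= eqxx big1 ?addr0 // => l /andP[_ /negPf ->] //.
  by rewrite big1 // => l /eqP lE; case: eqP => // lk; case: kE; rewrite -lk.
have AE : map_mx (meval (nz_entry (A := A))) (indet_mx A) = A.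
  apply/matrixP => i j; rewrite !mxE raddf_sum /=.
  under eq_bigr do rewrite mevalXU.
  have [Aij|Aij] := eqVneq (A i j) 0.
    rewrite Aij big1 // => k /eqP kE.
    by rewrite /nz_entry kE.
  have ijA : (i, j) \in nz_pos A by rewrite inE.
  rewrite (bigD1 (enum_rank_in ijA (i, j))) ?enum_rankK_in //=.
  rewrite /nz_entry enum_rankK_in // big1 ?addr0 // => k /andP[/eqP kE /negP[]].
  by apply/eqP/enum_val_inj; rewrite enum_rankK_in.
exists (\sum_k x k 0 *: D k).
  move=> i j Aij; rewrite summxE big1 // => k _; rewrite !mxE.
  case: andP => [[/eqP ei /eqP ej]|]; last by rewrite mulr0.
  by have := enum_valP k; rewrite inE -ei -ej Aij eqxx.
move=> i ltin; have iE : (n - (n - i.+1).+1)%N = i by lia.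
have <- : y (rev_ord (Ordinal ltin)) 0 = q i by rewrite mxE /= iE.
rewrite -Jx.
rewrite dchar_poly_sum coef_sum mxE; apply: eq_bigr => k _.
by rewrite coefCM mulrC [J _ _]mxE /= iE dchar_poly_mpoly DE AE.
Qed.

(** This makes the coefficients along an affine family through [B] polynomials in the parameters, so
    that the equations to be solved are polynomial ones with known derivatives at 0. *)
Lemma char_poly_affine_mpoly (T : comNzRingType) m n (B : 'M[T]_n)
    (V : 'I_m -> 'M[T]_n) k :
  exists2 F : {mpoly T[m]},
    forall z, F.@[z] = (char_poly (B + \sum_j z j *: V j))`_k &
    forall j, F^`M(j).@[fun=> 0] = (dchar_poly B (V j))`_k.
Proof.
pose M : 'M[{mpoly T[m]}]_n :=
  \matrix_(i, l) ((B i l)%:MP + \sum_j V j i l *: 'X_j).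
have ME z : map_mx (meval z) M = B + \sum_j z j *: V j.
  apply/matrixP => i l; rewrite !mxE summxE mevalD mevalC raddf_sum /=.
  by congr (_ + _); apply: eq_bigr => j _; rewrite mevalZ mevalXU mxE mulrC.
exists (char_poly M)`_k => [z|j].
  by rewrite -ME -map_char_poly coef_map.
rewrite dchar_poly_mpoly ME big1 ?addr0; last by move=> l _; rewrite scale0r.
congr ((dchar_poly _ _)`_k); apply/matrixP => i l; rewrite !mxE /=.
rewrite mderivD mderivC add0r (raddf_sum (mderiv j)) raddf_sum /= (bigD1 j) //= big1 => [|j' nj].
  by rewrite addr0 mderivZ mevalZ meval_mderivXU eqxx mulr1.
by rewrite mderivZ mevalZ meval_mderivXU (negPf nj) mulr0.
Qed.

(** * Strict differentiability of polynomial functions at the origin *)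

Section StrictDifferentiability.

Variables (R : realFieldType) (m : nat).
Implicit Types (f g : ('I_m -> R) -> R) (L M : 'I_m -> R).

(** Differentiability in two moving points, for the sup norm: this is what makes a map with zero
    derivative a contraction near 0. Quantifying over a bound [r] of the distance replaces the norm
    itself. *)
Definition strictly_differentiable0 f L :=
  forall e, 0 < e -> exists2 delta, 0 < delta &
  forall x y r, (forall i, `|x i| <= delta) -> (forall i, `|y i| <= delta) ->
    0 <= r -> (forall i, `|x i - y i| <= r) ->
    `|f x - f y - \sum_i L i * (x i - y i)| <= e * r.

Lemma eq_strictly_differentiable0 f g L M : f =1 g -> L =1 M ->
  strictly_differentiable0 f L -> strictly_differentiable0 g M.
Proof.
move=> fg LM df e /df[d d0 fd]; exists d => // x y r xd yd r0 xyr.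
by rewrite -!fg; under eq_bigr do rewrite -LM; exact: fd.
Qed.

Lemma strictly_differentiable0_cst c :
  strictly_differentiable0 (fun=> c) (fun=> 0).
Proof.
move=> e e0; exists 1 => // x y r _ _ r0 _.
by rewrite big1 ?subrr ?subr0 ?normr0 ?mulr_ge0 // 1?ltW // => i _; rewrite mul0r.
Qed.

Lemma strictly_differentiable0_proj j :
  strictly_differentiable0 (fun x => x j) (fun k => (j == k)%:R).
Proof.
move=> e e0; exists 1 => // x y r _ _ r0 _.
rewrite (bigD1 j) //= eqxx mul1r big1 => [|i]; last first.
  by rewrite eq_sym => /negPf ->; rewrite mul0r.
by rewrite addr0 subrr normr0 mulr_ge0 // ltW.
Qed.

Lemma strictly_differentiable0D f g L M :
  strictly_differentiable0 f L -> strictly_differentiable0 g M ->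
  strictly_differentiable0 (fun x => f x + g x) (fun i => L i + M i).
Proof.
move=> df dg e e0; have e20 : 0 < e / 2 by lra.
have [a a0 fa] := df _ e20; have [b b0 gb] := dg _ e20.
exists (Num.min a b); first by rewrite lt_min a0.
move=> x y r xd yd r0 xyr.
have xa i : `|x i| <= a by apply: le_trans (xd i) _; rewrite ge_min lexx.
have ya i : `|y i| <= a by apply: le_trans (yd i) _; rewrite ge_min lexx.
have xb i : `|x i| <= b by apply: le_trans (xd i) _; rewrite ge_min lexx orbT.
have yb i : `|y i| <= b by apply: le_trans (yd i) _; rewrite ge_min lexx orbT.
have := lerD (fa _ _ _ xa ya r0 xyr) (gb _ _ _ xb yb r0 xyr).
rewrite -mulrDl -splitr; apply: le_trans; apply: le_trans (ler_normD _ _).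
under eq_bigr do rewrite mulrDl.
rewrite big_split /=.
by rewrite le_eqVlt; apply/orP; left; apply/eqP; congr `|_|; ring.
Qed.

Lemma norm_linear_le L (h : 'I_m -> R) r : (forall i, `|h i| <= r) ->
  `|\sum_i L i * h i| <= (\sum_i `|L i|) * r.
Proof.
move=> hr; apply: le_trans (ler_norm_sum _ _ _) _.
by rewrite mulr_suml; apply: ler_sum => i _; rewrite normrM ler_wpM2l.
Qed.

Lemma strictly_differentiable0_continuous f L e :
  strictly_differentiable0 f L -> 0 < e ->
  exists2 delta, 0 < delta & forall x, (forall i, `|x i| <= delta) ->
    `|f x - f (fun=> 0)| <= e.
Proof.
move=> df e0; have [a a0 fa] := df 1 ltr01.
set K := 1 + \sum_i `|L i|.
have K0 : 0 < K by rewrite ltr_pwDl ?sumr_ge0.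
have eK : 0 < e / K by rewrite divr_gt0.
exists (Num.min a (e / K)); first by rewrite lt_min a0.
set d := Num.min _ _ => x xd.
have d0 : 0 <= d by rewrite le_min !ltW.
have xa i : `|x i| <= a by apply: le_trans (xd i) _; rewrite ge_min lexx.
have oa (i : 'I_m) : `|0 : R| <= a by rewrite normr0 ltW.
have xd' i : `|x i - 0| <= d by rewrite subr0.
have h1 := fa x (fun=> 0) d xa oa d0 xd'.
have h2 := norm_linear_le L xd'.
have -> : f x - f (fun=> 0) = (f x - f (fun=> 0) - \sum_i L i * (x i - 0))
   + \sum_i L i * (x i - 0) by ring.
apply: le_trans (ler_normD _ _) _; apply: le_trans (lerD h1 h2) _.
by rewrite -mulrDl mulrC -ler_pdivlMr // ge_min lexx orbT.
Qed.

Lemma strictly_differentiable0M f g L M :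
  strictly_differentiable0 f L -> strictly_differentiable0 g M ->
  strictly_differentiable0 (fun x => f x * g x)
    (fun i => L i * g (fun=> 0) + f (fun=> 0) * M i).
Proof.
move=> df dg e e0.
set f0 := f _; set g0 := g _.
set KL := \sum_i `|L i|; set KM := \sum_i `|M i|.
have KL0 : 0 <= KL by apply: sumr_ge0.
have KM0 : 0 <= KM by apply: sumr_ge0.
(* [C] will bound [f x] and [g y] near 0 as well as the norms of both linear parts. *)
pose C := `|f0| + `|g0| + 1 + KL + KM.
have f00 : 0 <= `|f0| by []; have g00 : 0 <= `|g0| by [].
have C0 : 0 < C by rewrite /C; lra.
(* The bound 1 keeps [f x] and [g y] below [C]; the other bound lets four errors of size C e1 r add
   up to at most e r. *)
pose e1 := Num.min 1 (e / (4 * C)).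
have e10 : 0 < e1 by rewrite lt_min ltr01 divr_gt0 // mulr_gt0.
have e11 : e1 <= 1 by rewrite ge_min lexx.
have e1C : 4 * C * e1 <= e.
  by rewrite mulrC -ler_pdivlMr ?mulr_gt0 // ge_min lexx orbT.
have [a a0 fa] := df _ e10; have [b b0 gb] := dg _ e10.
have [c c0 fc] := strictly_differentiable0_continuous df e10.
have [d d0 gd] := strictly_differentiable0_continuous dg e10.
exists (Num.min (Num.min a b) (Num.min c d)); first by rewrite !lt_min a0 b0 c0.
set D := Num.min _ _ => x y r xd yd r0 xyr.
have Da : D <= a by rewrite !ge_min lexx.
have Db : D <= b by rewrite !ge_min lexx orbT.
have Dc : D <= c by rewrite !ge_min lexx orbT.
have Dd : D <= d by rewrite !ge_min lexx !orbT.
have hf := fa _ _ _ (fun i => le_trans (xd i) Da) (fun i => le_trans (yd i) Da) r0 xyr.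
have hg := gb _ _ _ (fun i => le_trans (xd i) Db) (fun i => le_trans (yd i) Db) r0 xyr.
have cf := fc _ (fun i => le_trans (xd i) Dc).
have cg := gd _ (fun i => le_trans (yd i) Dd).
have lf := norm_linear_le L xyr; have lg := norm_linear_le M xyr.
rewrite -/f0 in cf; rewrite -/g0 in cg.
rewrite -/KL in lf; rewrite -/KM in lg.
under eq_bigr => i _ do
  rewrite mulrDl (mulrC (L i)) -!mulrA.
rewrite big_split /= -!mulr_sumr.
move: (\sum_i L i * _) (\sum_i M i * _) hf hg lf lg => l k hf hg lf lg.
(* Each of the four terms has one small factor: a linearization error, or the distance of a value
   from its value at 0. *)
have -> : f x * g x - f y * g y - (g0 * l + f0 * k) =
  f x * (g x - g y - k) + (f x - f0) * k + g y * (f x - f y - l) + (g y - g0) * l.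
  by ring.
have fx : `|f x| <= C.
  have -> : f x = f0 + (f x - f0) by ring.
  by apply: le_trans (ler_normD _ _) _; rewrite /C; lra.
have gy : `|g y| <= C.
  have -> : g y = g0 + (g y - g0) by ring.
  by apply: le_trans (ler_normD _ _) _; rewrite /C; lra.
have KLC : KL * r <= C * r by rewrite ler_wpM2r // /C; lra.
have KMC : KM * r <= C * r by rewrite ler_wpM2r // /C; lra.
have t1 : `|f x * (g x - g y - k)| <= C * (e1 * r) by rewrite normrM ler_pM.
have t3 : `|g y * (f x - f y - l)| <= C * (e1 * r) by rewrite normrM ler_pM.
have t2 : `|(f x - f0) * k| <= e1 * (C * r).
  by rewrite normrM ler_pM //; apply: le_trans lg _.
have t4 : `|(g y - g0) * l| <= e1 * (C * r).
  by rewrite normrM ler_pM //; apply: le_trans lf _.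
have e1Cr := ler_wpM2r r0 e1C.
move: t1 t2 t3 t4.
move: (f x * _) ((f x - f0) * k) (g y * _) ((g y - g0) * l) => t1 t2 t3 t4.
have := ler_normD (t1 + t2 + t3) t4; have := ler_normD (t1 + t2) t3.
have := ler_normD t1 t2.
move: `|_ + t2| `|_ + t3| `|_ + t4| `|t1| `|t2| `|t3| `|t4| => *.
by lra.
Qed.

Lemma mpoly_strictly_differentiable0 (p : {mpoly R[m]}) :
  strictly_differentiable0 (fun x => p.@[x]) (fun i => p^`M(i).@[fun=> 0]).
Proof.
pose P q := strictly_differentiable0 (fun x => q.@[x]) (fun i => q^`M(i).@[fun=> 0]).
have PC c : P c%:MP.
  apply: eq_strictly_differentiable0 (strictly_differentiable0_cst c).
    by move=> x; rewrite mevalC.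
  by move=> i; rewrite mderivC meval0.
have PD q1 q2 : P q1 -> P q2 -> P (q1 + q2).
  move=> h1 h2; apply: eq_strictly_differentiable0 (strictly_differentiable0D h1 h2).
    by move=> x; rewrite mevalD.
  by move=> i; rewrite mderivD mevalD.
have PM q1 q2 : P q1 -> P q2 -> P (q1 * q2).
  move=> h1 h2; apply: eq_strictly_differentiable0 (strictly_differentiable0M h1 h2).
    by move=> x; rewrite mevalM.
  by move=> i; rewrite mderivM mevalD !mevalM.
have PX j : P 'X_j.
  apply: eq_strictly_differentiable0 (strictly_differentiable0_proj j).
    by move=> x; rewrite mevalXU.
  by move=> i; rewrite meval_mderivXU.
have P1 : P 1 by rewrite -mpolyC1.
rewrite -/(P p) [p]mpolyE; apply: big_ind => [||k _]; [by rewrite -mpolyC0|exact: PD|].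
rewrite -mul_mpolyC; apply: (PM) => //; rewrite mpolyXE_id.
apply: big_ind => // i _; elim: (k i) => [|l IH]; first by rewrite expr0.
by rewrite exprS; apply: PM.
Qed.

End StrictDifferentiability.

(** * Fixed points of contractions and solutions of polynomial systems *)

(** The iterates from 0 stay in the ball, and in each coordinate the intervals of radius delta / 2^k
    around the k-th iterate are nested; the fixed point is their common point. *)
Lemma contraction_fixpoint (R : realType) N (T : ('I_N -> R) -> 'I_N -> R)
    (delta : R) :
  0 <= delta ->
  (forall x y r, (forall i, `|x i| <= delta) -> (forall i, `|y i| <= delta) ->
     0 <= r -> (forall i, `|x i - y i| <= r) ->
     forall i, `|T x i - T y i| <= r / 2) ->
  (forall i, `|T (fun=> 0) i| <= delta / 2) ->
  exists2 x, forall i, `|x i| <= delta & forall i, T x i = x i.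
Proof.
move=> d0 Tc T0.
pose X k := iter k T (fun=> 0).
have XS k : X k.+1 = T (X k) by [].
pose r k := delta * (1 / 2) ^+ k.
have rS k : r k.+1 = r k / 2 by rewrite /r exprS; field.
have r0 k : 0 <= r k by rewrite mulr_ge0 // exprn_ge0 //; lra.
have Tball x : (forall i, `|x i| <= delta) -> forall i, `|T x i| <= delta.
  move=> xd i; have h : `|T x i - T (fun=> 0) i| <= delta / 2.
    by apply: Tc => // j; rewrite ?normr0 ?subr0.
  have -> : T x i = (T x i - T (fun=> 0) i) + T (fun=> 0) i by ring.
  by apply: le_trans (ler_normD _ _) _; have := T0 i; lra.
have Xd k i : `|X k i| <= delta.
  elim: k i => [|k IH] i; first by rewrite /X /= normr0.
  by rewrite XS; apply: Tball.
have Xr k i : `|X k.+1 i - X k i| <= r k.+1.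
  elim: k i => [|k IH] i.
    by rewrite rS /r expr0 mulr1 /X /= subr0.
  by rewrite rS; exact: (Tc _ _ _ (Xd k.+1) (Xd k)).
have Xm k l i : `|X (k + l)%N i - X k i| <= r k - r (k + l)%N.
  elim: l => [|l IH]; first by rewrite addn0 !subrr normr0.
  have h := Xr (k + l)%N i; rewrite addnS.
  have -> : X (k + l).+1 i - X k i =
    (X (k + l).+1 i - X (k + l)%N i) + (X (k + l)%N i - X k i) by ring.
  by apply: le_trans (ler_normD _ _) _; rewrite rS in h *; lra.
(* These are the left ends of the nested intervals; their supremum is the limit. *)
pose E i : R -> Prop := fun y => exists k, y = X k i - r k.
have Eub i l y : E i y -> y <= X l i + r l.
  case=> k ->; have [kl|/ltnW lk] := leqP k l.
    have := Xm k (l - k)%N i; rewrite subnKC // ler_norml => /andP[h _].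
    by have := r0 l; lra.
  have := Xm l (k - l)%N i; rewrite subnKC // ler_norml => /andP[_ h].
  by have := r0 k; lra.
have E0 i : exists y, E i y by exists (X 0%N i - r 0%N), 0%N.
pose x i := sup (E i).
have xX k i : `|x i - X k i| <= r k.
  have le1 : X k i - r k <= x i.
    by apply: ub_le_sup; [exists (X 0%N i + r 0%N) => y; apply: Eub|exists k].
  have le2 : x i <= X k i + r k.
    by apply: ge_sup (E0 i) _ => y; apply: Eub.
  by rewrite ler_norml; lra.
have xd i : `|x i| <= delta.
  by have := xX 0%N i; rewrite /X /= subr0 /r expr0 mulr1.
exists x => // i.
have small k : `|T x i - x i| <= r k.
  have h1 : `|T x i - T (X k) i| <= r k / 2.
    exact: (Tc _ _ _ xd (Xd k) (r0 k) (xX k)).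
  have h2 := xX k.+1 i; rewrite XS rS distrC in h2.
  have -> : T x i - x i = (T x i - T (X k) i) + (T (X k) i - x i) by ring.
  by apply: le_trans (ler_normD _ _) _; lra.
apply/eqP; rewrite -subr_eq0 -normr_eq0; apply/eqP/le_anti; rewrite normr_ge0 andbT.
rewrite leNgt; apply/negP => a0.
(* This makes the radii tend to 0, by comparison with 1 / (k+1) and the Archimedean property. *)
have half k : k.+1%:R * (1 / 2) ^+ k <= 1 :> R.
  elim: k => [|k IH]; first by rewrite expr0 mulr1.
  have -> : k.+2%:R * (1 / 2) ^+ k.+1 = (k.+1%:R * (1 / 2) ^+ k + (1 / 2) ^+ k) / 2 :> R.
    by rewrite exprS -[k.+2]addn1 natrD; field.
  have : (1 / 2) ^+ k <= 1 :> R by apply: exprn_ile1; lra.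
  by lra.
set a := `|_| in small a0.
have [k kd] : exists k, delta / a < k%:R.
  by exists (Num.bound (delta / a)); rewrite archi_boundP // divr_ge0 // ltW.
have := small k; rewrite leNgt => /negP; apply.
move: kd; rewrite ltr_pdivrMr // => kd.
have ch := half k; rewrite -[k.+1%:R]natr1 in ch.
have h0 : 0 < (1 / 2) ^+ k :> R by apply: exprn_gt0; lra.
rewrite /r; move: ((1 / 2) ^+ k) (k%:R : R) kd h0 ch => h c kd h0 ch.
have h1 : 0 < (c * a - delta) * h by rewrite mulr_gt0 // subr_gt0.
have h2 : 0 <= a * (1 - (c + 1) * h) by apply: mulr_ge0; [exact: ltW|rewrite subr_ge0].
have h3 : 0 < a * h by rewrite mulr_gt0.
by lra.
Qed.

Lemma finite_common_radius (R : realFieldType) (I : finType) (P : I -> R -> Prop) :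
  (forall i d d', P i d -> 0 < d' -> d' <= d -> P i d') ->
  (forall i, exists2 d, 0 < d & P i d) ->
  exists2 d, 0 < d & forall i, P i d.
Proof.
move=> Pmono Pex.
suff [d d0 Pd] : exists2 d, 0 < d & forall i, i \in enum I -> P i d.
  by exists d => // i; apply: Pd; rewrite mem_enum.
elim: (enum I) => [|i s [d d0 Pd]]; first by exists 1.
have [c c0 Pc] := Pex i.
have m0 : 0 < Num.min c d by rewrite lt_min c0.
exists (Num.min c d) => // j; rewrite inE => /orP[/eqP->|/Pd Pj].
  by apply: Pmono Pc _ _ => //; rewrite ge_min lexx.
by apply: Pmono Pj _ _ => //; rewrite ge_min lexx orbT.
Qed.

(** Freeze the last variable at a small s > 0. The map sending x to x - F(x, s) then has zero
    derivative in x at the origin, so it contracts by 1/2 nearby, and its fixed points are the zeros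
    of F(., s). *)
Lemma mpoly_implicit_solution (R : realType) N (F : 'I_N -> {mpoly R[N.+1]})
    (delta : R) :
  (forall i, (F i).@[fun=> 0] = 0) ->
  (forall i j, (F i)^`M(lift ord_max j).@[fun=> 0] = (i == j)%:R) ->
  0 < delta ->
  exists z : 'I_N.+1 -> R, [/\ 0 < z ord_max, forall k, `|z k| <= delta
    & forall i, (F i).@[z] = 0].
Proof.
move=> F0 dF d0.
have e0 : 0 < 1 / 2 :> R by lra.
pose P i d := forall x y r, (forall k, `|x k| <= d) -> (forall k, `|y k| <= d) ->
    0 <= r -> (forall k, `|x k - y k| <= r) ->
    `|(F i).@[x] - (F i).@[y] - \sum_k (F i)^`M(k).@[fun=> 0] * (x k - y k)| <= 1 / 2 * r.
have [d1 d10 Pd1] : exists2 d, 0 < d & forall i, P i d.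
  apply: finite_common_radius => [i d d' Pd d'0 d'd x y r xd yd|i].
    by apply: Pd => k; apply: le_trans d'd.
  exact: mpoly_strictly_differentiable0.
pose d := Num.min delta d1.
have dd : d <= delta by rewrite ge_min lexx.
have dd1 : d <= d1 by rewrite ge_min lexx orbT.
have dgt0 : 0 < d by rewrite lt_min d0.
have d20 : 0 < d / 2 by lra.
(* By continuity a small s moves the starting point 0 by at most d / 2, as the contraction argument
   requires. *)
have [s0 s00 Ps0] : exists2 s, 0 < s & forall i, forall z : 'I_N.+1 -> R,
    (forall k, `|z k| <= s) -> `|(F i).@[z]| <= d / 2.
  apply: finite_common_radius => [i a a' Pa a'0 a'a z za|i].
    by apply: Pa => k; apply: le_trans a'a.
  have [a a0 ha] := strictly_differentiable0_continuous
    (@mpoly_strictly_differentiable0 _ _ (F i)) d20.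
  by exists a => // z za; have := ha _ za; rewrite F0 subr0.
pose s := Num.min s0 d.
have sgt0 : 0 < s by rewrite lt_min s00.
have ss0 : s <= s0 by rewrite ge_min lexx.
have sd : s <= d by rewrite ge_min lexx orbT.
pose zz (x : 'I_N -> R) k := if unlift ord_max k is Some j then x j else s.
have zzM x : zz x ord_max = s by rewrite /zz unlift_none.
have zzL x j : zz x (lift ord_max j) = x j by rewrite /zz liftK.
have zzd x b : (forall i, `|x i| <= b) -> s <= b -> forall k, `|zz x k| <= b.
  by move=> xb sb k; rewrite /zz; case: unliftP => [j _|_] //; rewrite gtr0_norm.
have [||x xd xfix] := @contraction_fixpoint _ N
    (fun x i => x i - (F i).@[zz x]) d (ltW dgt0).
- move=> x y r xd yd r0 xyr i.
  have zd t : (forall i, `|t i| <= d) -> forall k, `|zz t k| <= d1.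
    by move=> td k; apply: le_trans dd1; apply: zzd.
  have xyr' k : `|zz x k - zz y k| <= r.
    by rewrite /zz; case: unliftP => [j _|_] //; rewrite subrr normr0.
  have := Pd1 i _ _ _ (zd x xd) (zd y yd) r0 xyr'.
  rewrite (bigD1_ord ord_max) //= !zzM subrr mulr0 add0r.
  under eq_bigr do rewrite !zzL dF.
  rewrite (bigD1 i) //= eqxx (mul1r (x i - y i)) big1 ?addr0 => [|j]; last first.
    by rewrite eq_sym => /negPf ->; rewrite mul0r.
  move=> h.
  have -> : x i - (F i).@[zz x] - (y i - (F i).@[zz y]) =
    - ((F i).@[zz x] - (F i).@[zz y] - (x i - y i)) by ring.
  by rewrite normrN; apply: le_trans h _; lra.
- move=> i; rewrite sub0r normrN; apply: Ps0.
  by apply: zzd => [j|] //; rewrite normr0 ltW.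
exists (zz x); split=> [|k|i]; first by rewrite zzM.
  by apply: le_trans dd; apply: zzd.
by have := xfix i; lra.
Qed.

(** * Permutations and composite cycles *)

Definition perm_arcs n (s : 'S_n) (O : {set 'I_n}) : {set 'I_n * 'I_n} :=
  [set (k, s k) | k in O].

(** The cycle decomposition of [s] in the encoding of composite cycles, with one arc set for each
    orbit. *)
Definition perm_cycles n (s : 'S_n) : {set {set 'I_n * 'I_n}} :=
  perm_arcs s @: porbits s.

Lemma mem_perm_arcs n (s : 'S_n) O i j :
  ((i, j) \in perm_arcs s O) = (i \in O) && (j == s i).
Proof.
apply/imsetP/andP => [[k kO [-> ->]]|[iO /eqP ->]]; first by rewrite kO.
by exists i.
Qed.

Lemma cycle_vertices_perm_arcs n (s : 'S_n) O : cycle_vertices (perm_arcs s O) = O.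
Proof.
apply/setP => i; apply/imsetP/idP => [[[a b]]|iO].
  by rewrite mem_perm_arcs => /andP[aO _] ->.
by exists (i, s i) => //; rewrite mem_perm_arcs iO eqxx.
Qed.

Lemma perm_arcs_inj n (s : 'S_n) : injective (perm_arcs s).
Proof. exact: can_inj (cycle_vertices_perm_arcs s). Qed.

Lemma perm_cyclesP n (s : 'S_n) i j :
  reflect (exists2 C, C \in perm_cycles s & (i, j) \in C) (j == s i).
Proof.
apply: (iffP eqP) => [->|[_ /imsetP[O _ ->]]].
  exists (perm_arcs s (porbit s i)); first by rewrite !imset_f.
  by rewrite mem_perm_arcs porbit_id eqxx.
by rewrite mem_perm_arcs => /andP[_ /eqP].
Qed.

Lemma perm_cycles_inj n : injective (@perm_cycles n).
Proof.
move=> s t st; apply/permP => i; apply/eqP/perm_cyclesP; rewrite -st.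
exact/perm_cyclesP.
Qed.

Lemma simple_cycle_arc n (G : rel 'I_n) C i j :
  simple_cycle G C -> (i, j) \in C -> G i j.
Proof.
case/existsP=> k /existsP[p /andP[/andP[cp _] /eqP ->]].
by case/imsetP=> x xp [-> ->]; apply: next_cycle.
Qed.

(** The list x, s x, s (s x), ... closes up once the orbit is exhausted. Only the arcs of this orbit
    are required to lie in [G], because [cofactor_off_cycle_eq0] uses permutations that may leave
    [G] elsewhere. *)
Lemma porbit_simple_cycle n (G : rel 'I_n) (s : 'S_n) x :
  (forall k, k \in porbit s x -> G k (s k)) ->
  simple_cycle G (perm_arcs s (porbit s x)).
Proof.
move=> Gs; have := card_porbit_neq0 s x; have := uniq_traject_porbit s x.
have := iter_porbit s x; have pE := porbit_traject s x.
have := max_card (porbit s x); rewrite card_ord.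
case: #|porbit s x| pE => // l pE ln itx up _.
pose p := traject s x l.+1.
have fp : fcycle s p.
  rewrite /p /= rcons_path fpath_traject /=.
  by rewrite last_traject; apply/eqP; rewrite -iterS itx.
have nextp k : k \in p -> next p k = s k.
  by move=> kp; have /eqP := next_cycle fp kp.
have sp : size p == l.+1 by rewrite size_traject.
apply/existsP; exists (Ordinal ln); apply/existsP; exists (Tuple sp).
apply/andP; split; first (apply/andP; split=> //).
  by apply: cycle_from_next => // k kp; rewrite nextp // Gs // pE.
apply/eqP/setP => -[a b]; rewrite mem_perm_arcs.
apply/andP/imsetP => [[ap /eqP ->]|[k kp [-> ->]]].
  by rewrite pE in ap; exists a => //; rewrite (nextp a ap).
by rewrite pE; split=> //; apply/eqP/nextp.
Qed.

Lemma fcycle_porbit n (s : 'S_n) (p : seq 'I_n) x :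
  fcycle s p -> x \in p -> porbit s x =i p.
Proof.
move=> fp xp y; rewrite -(fconnect_cycle fp xp).
apply/porbitP/idP => [[i ->]|/iter_findex <-]; first by rewrite permX fconnect_iter.
by eexists; rewrite permX.
Qed.

Lemma perm_cycles_composite n (G : rel 'I_n) (s : 'S_n) :
  (forall k, G k (s k)) -> composite_cycle G n (perm_cycles s).
Proof.
move=> Gs; apply/and3P; split.
- apply/forall_inP => _ /imsetP[_ /imsetP[x _ ->] ->].
  exact: porbit_simple_cycle.
- apply/forall_inP => _ /imsetP[_ /imsetP[x _ ->] ->].
  apply/forall_inP => _ /imsetP[_ /imsetP[y _ ->] ->].
  apply/implyP; apply: contraR; rewrite !cycle_vertices_perm_arcs => /pred0Pn[z].
  move=> /andP[/= zx zy]; apply/eqP; congr perm_arcs.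
  by move: zx zy; rewrite -!eq_porbit_mem => /eqP <- /eqP <-.
- suff -> : \bigcup_(C in perm_cycles s) cycle_vertices C = setT.
    by rewrite cardsT card_ord.
  apply/setP => i; rewrite inE; apply/bigcupP.
  exists (perm_arcs s (porbit s i)); first by rewrite !imset_f.
  by rewrite cycle_vertices_perm_arcs porbit_id.
Qed.

(** The cycles are disjoint and cover all vertices, so each vertex has exactly one outgoing arc in
    [S]; following it is a permutation. *)
Lemma composite_cycle_perm n (G : rel 'I_n) S :
  composite_cycle G n S ->
  exists2 s : 'S_n, forall k, G k (s k) & perm_cycles s = S.
Proof.
case/and3P=> /forall_inP simS /forall_inP disS /eqP cardS.
have disS' C1 C2 x : C1 \in S -> C2 \in S -> x \in cycle_vertices C1 ->
    x \in cycle_vertices C2 -> C1 = C2.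
  move=> C1S C2S x1 x2; apply/eqP; apply: contraTT x2 => C12.
  have /forall_inP/(_ _ C2S)/implyP/(_ C12) := disS _ C1S.
  by move/disjointFr => ->.
have covS x : exists2 C, C \in S & x \in cycle_vertices C.
  apply/bigcupP; suff -> : \bigcup_(C in S) cycle_vertices C = [set: 'I_n] by [].
  by apply/eqP; rewrite eqEcard subsetT cardsT card_ord cardS leqnn.
have cycS C : C \in S -> exists p : seq 'I_n, [/\ uniq p, p != [::] & C = arcs_of p].
  move=> /simS /existsP[k /existsP[p /andP[/andP[_ up] /eqP ->]]].
  by exists p; split=> //; rewrite -size_eq0 size_tuple.
have vert p x : (x \in cycle_vertices (arcs_of p)) = (x \in p).
  apply/imsetP/idP => [[_ /imsetP[i ip ->] ->]|xp] //.
  by exists (x, next p x) => //; apply: imset_f.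
(* The head of the arc of [S] leaving i. The default never occurs, since [S] covers i. *)
pose f i := odflt i [pick j | [exists C in S, (i, j) \in C]].
have fP C p i : C \in S -> C = arcs_of p -> i \in p -> f i = next p i.
  move=> CS Cp ip; rewrite /f; case: pickP => [j /exists_inP[C' C'S ijC']|/(_ (next p i))] /=.
    have C'C : C' = C.
      apply: (disS' _ _ i) => //; last by rewrite Cp vert.
      by apply/imsetP; exists (i, j).
    by move: ijC'; rewrite C'C Cp => /imsetP[k _ [-> ->]].
  by move=> /negbT/negP[]; apply/exists_inP; exists C => //; rewrite Cp; apply: imset_f.
have finj : injective f.
  move=> i j fij; have [C CS iC] := covS i; have [D DS jD] := covS j.
  have [p [up _ Cp]] := cycS _ CS; have [q [uq _ Dq]] := cycS _ DS.
  move: iC jD; rewrite Cp Dq !vert => ip jq.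
  have fi := fP _ _ _ CS Cp ip; have fj := fP _ _ _ DS Dq jq.
  (* Two vertices with the same successor lie on the same cycle, where [next] is inverted by
     [prev]. *)
  have CD : C = D.
    apply: (disS' _ _ (f i)) => //; first by rewrite Cp vert fi mem_next.
    by rewrite Dq vert fij fj mem_next.
  have jp : j \in p by rewrite -vert -Cp CD Dq vert.
  have := fP _ _ _ CS Cp jp; rewrite -fij fi => /(congr1 (prev p)).
  by rewrite !prev_next.
pose s := perm finj.
have sE C p x : C \in S -> C = arcs_of p -> uniq p -> x \in p ->
    perm_arcs s (porbit s x) = C.
  move=> CS Cp up xp.
  have fp : fcycle s p.
    by apply: cycle_from_next => // k kp; rewrite /= permE (fP _ _ _ CS Cp).
  rewrite Cp; apply/setP => -[a b]; rewrite mem_perm_arcs (fcycle_porbit fp xp).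
  apply/andP/imsetP => [[ap /eqP ->]|[k kp [-> ->]]].
    by exists a => //; rewrite permE (fP _ _ _ CS Cp).
  by rewrite kp permE (fP _ _ _ CS Cp).
exists s => [k|].
  have [C CS kC] := covS k; have [p [up _ Cp]] := cycS _ CS.
  apply: (simple_cycle_arc (simS _ CS)); move: kC; rewrite Cp vert => kp.
  by rewrite permE (fP _ _ _ CS Cp kp); apply: imset_f.
apply/setP => C; apply/idP/idP => [/imsetP[_ /imsetP[x _ ->] ->]|CS].
  have [C' CS kC] := covS x; have [p [up _ Cp]] := cycS _ CS.
  by rewrite (sE _ _ _ CS Cp) //; rewrite Cp vert in kC.
have [p [up pn0 Cp]] := cycS _ CS; case: p up pn0 Cp => // x p up _ Cp.
by rewrite -(sE _ _ x CS Cp up) ?inE ?eqxx // !imset_f.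
Qed.

(** The parity of [s] is that of n plus the number of its orbits, and the orbits partition the
    vertices, so the product over cycles is the product over all vertices. *)
Lemma signed_composite_weight_perm (R : realType) n (A : 'M[R]_n) (s : 'S_n) :
  signed_composite_weight A (perm_cycles s) =
  (-1) ^+ n * ((-1) ^+ s * \prod_i A i (s i)).
Proof.
rewrite mulrA; congr (_ * _).
  rewrite card_imset; last exact: perm_arcs_inj.
  rewrite /odd_perm card_ord signr_addb !signr_odd mulrA -signr_odd.
  by rewrite -expr2 sqrr_sign mul1r.
rewrite /composite_weight big_imset /=; last by move=> ? ? _ _; apply: perm_arcs_inj.
have tr : trivIset (porbits s).
  apply/trivIsetP => _ _ /imsetP[x _ ->] /imsetP[y _ ->]; apply: contraR.
  case/pred0Pn=> z /andP[/= zx zy].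
  by move: zx zy; rewrite -!eq_porbit_mem => /eqP <- /eqP <-.
have cov : cover (porbits s) = setT.
  apply/setP => i; rewrite inE; apply/bigcupP; exists (porbit s i).
    exact: imset_f.
  exact: porbit_id.
transitivity (\prod_(i in cover (porbits s)) A i (s i)).
  rewrite big_trivIset //; apply: eq_bigr => O _.
  by rewrite /cycle_weight big_imset //= => ? ? _ _ [].
by apply: eq_bigl => i; rewrite cov inE.
Qed.

(** The composite n-cycles through (u, v) are the permutations along nonzero entries that send u to
    v. All other permutations sending u to v contribute 0 to the Leibniz expansion, so the sum in
    (ii) is a cofactor up to a nonzero factor. *)
Lemma sum_composite_weight_cofactor (R : realType) n (A : 'M[R]_n) u v :
  \sum_(S | composite_cycle (mx_digraph A) n S && uses_arc S (u, v))
     signed_composite_weight A S = (-1) ^+ n * (A u v * cofactor A u v).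
Proof.
pose Ps := [set s : 'S_n | [forall k, mx_digraph A k (s k)] && (s u == v)].
transitivity (\sum_(S in @perm_cycles n @: Ps) signed_composite_weight A S).
  apply: eq_bigl => S; apply/andP/imsetP.
    move=> [/composite_cycle_perm[s Gs sS] /exists_inP[C CS uvC]].
    exists s => //; rewrite inE; apply/andP; split; first exact/forallP.
    by rewrite eq_sym; apply/perm_cyclesP; rewrite sS; exists C.
  move=> [s]; rewrite inE => /andP[/forallP Gs suv ->].
  split; first exact: perm_cycles_composite.
  by apply/exists_inP/perm_cyclesP; rewrite eq_sym.
rewrite big_imset /=; last by move=> ? ? _ _; apply: perm_cycles_inj.
under eq_bigr do rewrite signed_composite_weight_perm.
rewrite -mulr_sumr; congr (_ * _); rewrite expand_cofactor mulr_sumr.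
rewrite big_mkcond [RHS]big_mkcond /=; apply: eq_bigr => s _; rewrite inE.
case: eqP => [suv|]; last by rewrite andbF.
have pE : \prod_i A i (s i) = A u v * \prod_(k | u != k) A k (s k).
  by rewrite (bigD1 u) //= suv; congr (_ * _); apply: eq_bigl => k; rewrite eq_sym.
rewrite andbT mulrCA -pE; case: forallP => // nG.
have [k Ak] : exists k, A k (s k) = 0.
  have /forallPn[k] : ~~ [forall k, mx_digraph A k (s k)] by apply/forallP.
  by rewrite negbK => /eqP; exists k.
by rewrite (bigD1 k) //= Ak mul0r mulr0.
Qed.

(** * The characteristic polynomial of a triangle extension *)

(** In a Leibniz term with s u = j, the cycle of s through u avoids both (u, u) and (u, v), so by
    the cycle hypothesis one of its arcs is missing from [G]. The term has a zero factor there. *)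
Lemma cofactor_off_cycle_eq0 (T : comNzRingType) n (G : rel 'I_n) (u v j : 'I_n)
    (M : 'M[T]_n) :
  (forall i k, ~~ G i k -> M i k = 0) ->
  (forall C, simple_cycle G C -> u \in cycle_vertices C ->
     (u, u) \in C \/ (u, v) \in C) ->
  j != u -> j != v -> (M u j)%:P * cofactor (char_poly_mx M) u j = 0.
Proof.
move=> MG cyc ju jv; rewrite expand_cofactor mulr_sumr big1 // => s /eqP suj.
rewrite mulrCA.
have [Gs|/forall_inPn[k kp nG]] := boolP [forall k in porbit s u, G k (s k)].
  have := cyc _ (porbit_simple_cycle (forall_inP Gs)).
  rewrite cycle_vertices_perm_arcs porbit_id => /(_ isT).
  rewrite !mem_perm_arcs suj => -[] /andP[_]; last by rewrite eq_sym (negPf jv).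
  by rewrite eq_sym (negPf ju).
have [ku|ku] := eqVneq u k.
  by rewrite -suj {1}ku MG ?polyC0 ?mul0r ?mulr0 // ku.
rewrite (bigD1 k) //= !mxE (MG k) // polyC0 subr0; case: eqP => [ksk|_]; last first.
  by rewrite mulr0n mul0r !mulr0.
(* On the diagonal the entry would contain z, but a fixed point k is alone in its orbit, which
   contains u. *)
case/negP: ku; move: kp; rewrite porbit_sym => /porbitP[i ->].
by rewrite permX iter_fix.
Qed.

Lemma det_last_row (T : comNzRingType) n (N : 'M[T]_n.+1) :
  (forall j, N ord_max (lift ord_max j) = 0) ->
  \det N = N ord_max ord_max *
    \det (\matrix_(i < n, j < n) N (lift ord_max i) (lift ord_max j)).
Proof.
move=> N0; rewrite (expand_det_row _ ord_max) (bigD1 ord_max) //= big1 ?addr0.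
  rewrite /cofactor addnn -signr_odd odd_double expr0 mul1r; congr (_ * \det _).
  by apply/matrixP => i j; rewrite !mxE.
by move=> j; case: (unliftP ord_max j) => [k ->|->]; rewrite ?eqxx // N0 mul0r.
Qed.

(* The Schur complement of the last diagonal entry [d], with denominators
   cleared so that [d] need not be invertible. *)
Lemma det_schur_last (T : comNzRingType) n (N : 'M[T]_n.+1) :
  let d := N ord_max ord_max in
  \det N * d ^+ n = d * \det (\matrix_(i < n, j < n)
    (d * N (lift ord_max i) (lift ord_max j)
     - N (lift ord_max i) ord_max * N ord_max (lift ord_max j))).
Proof.
(* Right multiplication by [K] multiplies the other columns by d and subtracts multiples of the last
   one, clearing the last row except for d. *)
move=> d; pose K : 'M[T]_n.+1 := \matrix_(x, y)
  match unlift ord_max x, unlift ord_max y with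
  | Some i, Some j => d *+ (i == j)
  | Some i, None => 0
  | None, Some j => - N ord_max (lift ord_max j)
  | None, None => 1
  end.
have KLL i j : K (lift ord_max i) (lift ord_max j) = d *+ (i == j).
  by rewrite mxE !liftK.
have KLM i : K (lift ord_max i) ord_max = 0 by rewrite mxE liftK unlift_none.
have KML j : K ord_max (lift ord_max j) = - N ord_max (lift ord_max j).
  by rewrite mxE liftK unlift_none.
have KMM : K ord_max ord_max = 1 by rewrite mxE unlift_none.
have detK : \det K = d ^+ n.
  rewrite -det_tr det_last_row => [|j]; last by rewrite mxE KLM.
  rewrite mxE KMM mul1r -(det_scalar n d); congr (\det _).
  by apply/matrixP => i j; rewrite !mxE !liftK eq_sym.
have NKL x j : (N *m K) x (lift ord_max j) =
    N x (lift ord_max j) * d - N x ord_max * N ord_max (lift ord_max j).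
  rewrite mxE (bigD1_ord ord_max) //= KML mulrN addrC; congr (_ - _).
  rewrite (bigD1 j) //= KLL eqxx mulr1n big1 ?addr0 // => i ij.
  by rewrite KLL (negPf ij) mulr0n mulr0.
rewrite -detK -det_mulmx (det_last_row (N := N *m K)) => [|j]; last first.
  by rewrite NKL -/d mulrC subrr.
have -> : (N *m K) ord_max ord_max = d.
  rewrite mxE (bigD1_ord ord_max) //= KMM mulr1 big1 ?addr0 // => i _.
  by rewrite KLM mulr0.
congr (d * _); congr (\det _).
by apply/matrixP => i j; rewrite [LHS]mxE NKL [RHS]mxE mulrC.
Qed.

Definition triangle_ext_mx (T : nzRingType) n (M : 'M[T]_n) (u v : 'I_n) (c e : T) :
    'M[T]_n.+1 :=
  \matrix_(x, y) match unlift ord_max x, unlift ord_max y with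
    | Some i, Some j => if (i, j) == (u, u) then 0 else M i j
    | Some i, None => c *+ (i == u)
    | None, Some j => e *+ (j == v)
    | None, None => M u u
    end.

(** Eliminating the new vertex from z - M' by [det_schur_last] gives d times z - M, with d = z -
    M_uu, except in row u at the columns u and v. Expanding both determinants along row u compares
    them, and the power of d cancels in an integral domain. *)
Lemma char_poly_triangle_ext_mx (T : idomainType) n (M : 'M[T]_n) u v c e :
  u != v ->
  (forall j, j != u -> j != v -> (M u j)%:P * cofactor (char_poly_mx M) u j = 0) ->
  char_poly (triangle_ext_mx M u v c e) = 'X * char_poly M
    + (M u u * M u v - c * e)%:P * cofactor (char_poly_mx M) u v.
Proof.
move=> uv M0; set N := char_poly_mx M; set N1 := char_poly_mx (triangle_ext_mx M u v c e).
pose d : {poly T} := 'X - (M u u)%:P.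
have d0 : d != 0 by rewrite polyXsubC_eq0.
have N1MM : N1 ord_max ord_max = d by rewrite !mxE eqxx !unlift_none.
have N1LM i : N1 (lift ord_max i) ord_max = - (c%:P *+ (i == u)).
  by rewrite !mxE liftK unlift_none eq_sym (negPf (neq_lift _ _)) sub0r polyCMn.
have N1ML j : N1 ord_max (lift ord_max j) = - (e%:P *+ (j == v)).
  by rewrite !mxE liftK unlift_none (negPf (neq_lift _ _)) sub0r polyCMn.
have N1LL i j : N1 (lift ord_max i) (lift ord_max j) =
    if (i, j) == (u, u) then 'X else N i j.
  rewrite !mxE !liftK (inj_eq lift_inj); case: ifP => // /eqP[-> ->].
  by rewrite eqxx polyC0 subr0.
have := det_schur_last N1; rewrite /= N1MM.
set Z := \matrix_(i, j) _ => schur.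
have n0 : n = n.-1.+1 by rewrite prednK // (leq_ltn_trans _ (ltn_ord u)).
have ZE i j : Z i j = d * (if (i, j) == (u, u) then 'X else N i j)
    - (c * e)%:P *+ ((i == u) && (j == v)).
  rewrite mxE N1LM N1ML N1LL; congr (_ - _).
  by case: (i == u); case: (j == v);
    rewrite ?mulr1n ?mulr0n ?mulrNN ?oppr0 ?mulr0 ?mul0r ?polyCM.
(* Outside row u the matrix [Z] is d times [N], so a minor of order n - 1 gains d^(n-1). *)
have cofZ j : cofactor Z u j = d ^+ n.-1 * cofactor N u j.
  rewrite /cofactor mulrCA -detZ; congr (_ * \det _); apply/matrixP => k l.
  rewrite [in LHS]mxE [in LHS]mxE ZE xpair_eqE eq_sym (negPf (neq_lift _ _)).
  by rewrite /= mulr0n subr0 [RHS]mxE; congr (_ * _); rewrite [RHS]mxE [RHS]mxE.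
have vu : v != u by rewrite eq_sym.
have rowE (Y : 'M[{poly T}]_n) (f : 'I_n -> {poly T}) :
    (forall j, j != u -> j != v -> Y u j * f j = 0) ->
    \sum_j Y u j * f j = Y u u * f u + Y u v * f v.
  move=> Y0; rewrite (bigD1 u) // (bigD1 v) //= big1 ?addr0 // => j /andP[].
  exact: Y0.
have NE j : j != u -> N u j = - (M u j)%:P.
  by rewrite eq_sym !mxE => /negPf ->; rewrite sub0r.
have cpM : char_poly M = d * cofactor N u u - (M u v)%:P * cofactor N u v.
  rewrite /char_poly (expand_det_row _ u) rowE => [|j ju jv].
    by rewrite -/N (NE v) // mulNr; congr (_ * _ + _); rewrite !mxE eqxx.
  by rewrite -/N NE // mulNr M0 // oppr0.
have detZ : \det Z = d ^+ n.-1 * (d * ('X * cofactor N u u - (M u v)%:P * cofactor N u v)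
    - (c * e)%:P * cofactor N u v).
  rewrite (expand_det_row _ u) rowE => [|j ju jv]; last first.
    rewrite cofZ ZE xpair_eqE eqxx (negPf ju) (negPf jv) /= mulr0n subr0 NE //.
    by rewrite mulrN mulNr mulrACA M0 // mulr0 oppr0.
  rewrite !cofZ !ZE !xpair_eqE !eqxx (negPf vu) (negPf uv) /= mulr0n mulr1n (NE v) //.
  by ring.
have dn0 : d ^+ n != 0 by rewrite expf_neq0.
apply: (mulIf dn0); rewrite [LHS]schur detZ cpM polyCB !polyCM.
have -> : d ^+ n = d * d ^+ n.-1 by rewrite -exprS -n0.
by rewrite /d; ring.
Qed.

(** Since z - A divides z^k - A^k = z^k, the characteristic polynomial divides a power of z; it is
    monic of degree n. *)
Lemma char_poly_nilpotent (F : fieldType) n (A : 'M[F]_n) k :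
  A ^+ k = 0 -> char_poly A = 'X^n.
Proof.
case: n A => [|n] A A0; first by rewrite /char_poly det_mx00 expr0.
have dvd : char_poly A %| ('X - 0%:P) ^+ (n.+1 * k).
  rewrite subr0 exprM.
  have -> : ('X ^+ n.+1) ^+ k = \det (('X%:M : 'M[{poly F}]_n.+1) ^+ k - map_mx polyC A ^+ k).
    have -> : map_mx polyC A ^+ k = 0 by rewrite -rmorphXn A0 raddf0.
    by rewrite subr0 -rmorphXn /= det_scalar -!exprM mulnC.
  rewrite subrXX_comm; last exact: comm_scalar_mx.
  by rewrite det_mulmx; apply: dvdp_mulr.
have /dvdp_exp_XsubCP[m _] := dvd; rewrite eqp_monic ?char_poly_monic ?monic_exp ?monicXsubC //.
rewrite subr0 => /eqP cE; have := size_char_poly A.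
by rewrite cE size_polyXn => -[->].
Qed.

Lemma coef_comp_scaleX (T : comNzRingType) (p : {poly T}) c i :
  (p \Po (c *: 'X))`_i = p`_i * c ^+ i.
Proof.
rewrite comp_polyE coef_sum.
under eq_bigr do rewrite exprZn !coefZ coefXn.
have [ip|pi] := ltnP i (size p); last first.
  rewrite nth_default // mul0r big1 // => j _.
  by rewrite gtn_eqF ?mulr0 // (leq_trans (ltn_ord j)).
rewrite (bigD1 (Ordinal ip)) //= eqxx mulr1 big1 ?addr0 // => j ji.
have [ij|_] := eqVneq i (j : nat); last by rewrite !mulr0.
by case/eqP: ji; apply: val_inj.
Qed.

(** This rests on det (z - a M) = a^n det (z / a - M). *)
Lemma coef_char_polyZ (F : fieldType) n (M : 'M[F]_n) a i :
  a != 0 -> (i <= n)%N -> (char_poly (a *: M))`_i = a ^+ (n - i) * (char_poly M)`_i.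
Proof.
move=> a0 le_in.
have -> : char_poly (a *: M) = (a ^+ n)%:P * (char_poly M \Po (a^-1 *: 'X)).
  rewrite /char_poly -det_map_mx polyC_exp -detZ; congr (\det _).
  apply/matrixP => k l; rewrite !mxE polyCM /= comp_polyB comp_polyC mulrBr; congr (_ - _).
  case: (k == l); last by rewrite !mulr0n comp_poly0 mulr0.
  by rewrite !mulr1n comp_polyX -mul_polyC mulrA -polyCM mulfV // mul1r.
rewrite coefCM coef_comp_scaleX mulrCA exprVn mulrC; congr (_ * _).
by rewrite expfB_cond // (negPf a0).
Qed.

Lemma triangle_ext_onto (R : realType) n (A : 'M[R]_n) (u v : 'I_n) (c e : R)
    (q : nat -> R) :
  u != v ->
  (forall C, simple_cycle (mx_digraph A) C -> u \in cycle_vertices C ->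
     (u, u) \in C \/ (u, v) \in C) ->
  full_rank_jacobian A ->
  (cofactor (char_poly_mx A) u v)`_0 != 0 ->
  A u u != 0 -> c != 0 -> e != 0 -> c * e = A u u * A u v ->
  exists2 V : 'M[R]_n.+1, forall x y, triangle_ext_mx A u v c e x y = 0 -> V x y = 0 &
    forall i, (i < n.+1)%N -> (dchar_poly (triangle_ext_mx A u v c e) V)`_i = q i.
Proof.
move=> uv cyc frk Q0 Auu c0 e0 ce.
set Q := cofactor (char_poly_mx A) u v.
(* The product z D has no constant term, so k alone must match q 0; D then absorbs the remaining
   coefficients. *)
pose k := q 0%N / Q`_0.
have [V AV DV] := full_rank_jacobian_onto (fun i => q i.+1 - k * Q`_i.+1) frk.
pose M : 'M[{poly R}]_n := \matrix_(i, j) ((A i j)%:P + V i j *: 'X).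
have M0 : map_mx (coefp 0) M = A.
  by apply/matrixP => i j; rewrite !mxE /= coefD coefC coefZ coefX mulr0 addr0.
have M1 : map_mx (coefp 1) M = V.
  by apply/matrixP => i j; rewrite !mxE /= coefD coefC coefZ coefX mulr1 add0r.
have M0E i j : (M i j)`_0 = A i j by rewrite -[in RHS]M0 [RHS]mxE.
have M1E i j : (M i j)`_1 = V i j by rewrite -[in RHS]M1 [RHS]mxE.
have MG i j : ~~ mx_digraph A i j -> M i j = 0.
  by rewrite negbK => /eqP Aij; rewrite mxE Aij AV // scale0r addr0.
(* Chosen so that M_uu M_uv - c e is exactly k times the curve parameter, while c has its prescribed
   value at parameter 0. *)
pose ct : {poly R} := e^-1 *: (M u u * M u v - k *: 'X).
have ct0 : ct`_0 = c.
  rewrite coefZ coefB coefZ coefX mulr0 subr0 coef0M.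
  by rewrite !M0E -ce mulrC mulfK.
pose Bt := triangle_ext_mx M u v ct e%:P.
have B0 : map_mx (coefp 0) Bt = triangle_ext_mx A u v c e.
  apply/matrixP => x y; rewrite [LHS]mxE [Bt x y]mxE [RHS]mxE.
  case: unliftP => [i _|_]; case: unliftP => [j _|_] /=.
  - by case: ifP => _; rewrite ?coef0.
  - by rewrite coefMn ct0.
  - by rewrite coefMn coefC.
  - exact: M0E.
exists (map_mx (coefp 1) Bt) => [x y|i ltin].
  rewrite [triangle_ext_mx _ _ _ _ _ _ _]mxE [map_mx _ _ _ _]mxE [Bt x y]mxE.
  case: unliftP => [a _|_]; case: unliftP => [b _|_] /=.
  - by case: ifP => _; [rewrite coef0|rewrite M1E; apply: AV].
  - by case: (a == u) => [/eqP|]; rewrite ?mulr0n ?coef0 // (negPf c0).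
  - by rewrite coefMn coefC mul0rn.
  - by move/eqP; rewrite (negPf Auu).
rewrite -B0 -dchar_poly_curve char_poly_triangle_ext_mx //; last first.
  by move=> j; apply: cofactor_off_cycle_eq0 MG cyc.
have -> : M u u * M u v - ct * e%:P = k *: 'X.
  by rewrite [ct * _]mulrC mul_polyC scalerA mulfV // scale1r opprB addrC subrK.
rewrite coefD coefXM coefCM coefD -scalerAl coefZ coefXM /=.
(* The factor k times the parameter is already of first order, so the cofactor enters only through
   its value at [A]. *)
have -> : (cofactor (char_poly_mx M) u v)`_i`_0 = Q`_i.
  rewrite -[LHS]/(coefp 0 _) -coef_map -cofactor_map_mx map_char_poly_mx M0 //.
case: i ltin => [|i] ltin /=; first by rewrite coef0 add0r /k divfK.
by rewrite dchar_poly_curve M0 M1 DV // subrK.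
Qed.

(** * Signs of entries and the nilpotent-Jacobian method *)

Lemma has_signP (R : realType) s (x : R) :
  has_sign s x <-> Num.sg x = (int_of_sign s)%:~R.
Proof.
case: s => /=; split=> h.
- by rewrite h sgr0.
- by apply/eqP; rewrite -sgr_eq0 h.
- by rewrite gtr0_sg.
- by rewrite -sgr_gt0 h ltr01.
- by rewrite ltr0_sg.
- by rewrite -sgr_lt0 h ltrN10.
Qed.

Lemma has_sign_perturb (R : realType) s (x h : R) :
  has_sign s x -> `|h| < `|x| -> has_sign s (x + h).
Proof.
case: s => /= [->|x0|x0]; first by rewrite normr0 normr_lt0.
  by rewrite (gtr0_norm x0) ltr_norml => /andP[]; lra.
by rewrite (ltr0_norm x0) ltr_norml => /andP[]; lra.
Qed.

Lemma has_signZ (R : realType) s (a x : R) :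
  0 < a -> has_sign s x -> has_sign s (a * x).
Proof.
by move=> a0; case: s => /= [->|x0|x0]; rewrite ?mulr0 ?pmulr_rgt0 ?pmulr_rlt0.
Qed.

Lemma mderiv_exp_other (T : comNzRingType) m (i j : 'I_m) k :
  i != j -> ('X_i ^+ k : {mpoly T[m]})^`M(j) = 0.
Proof.
move=> ij; elim: k => [|k IH]; first by rewrite expr0 -mpolyC1 mderivC.
by rewrite exprS mderivM IH mulr0 addr0 mderivX mnm1E (negPf ij) scale0r mul0r.
Qed.

(* The nilpotent-Jacobian method.  The unknown [z] collects a perturbation of the
   entries of [B] and a scale [t] (the last variable), which also multiplies the
   new entries of the superpattern; the equations say that the perturbed matrix
   has the roots of [p] multiplied by [t], so dividing it by [t] realizes [p]. *)
Lemma nilpotent_jacobian (R : realType) N (PB : sign_pattern N) (B : 'M[R]_N) :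
  has_pattern PB B -> char_poly B = 'X^N ->
  (forall q : nat -> R, exists2 V : 'M[R]_N, forall x y, B x y = 0 -> V x y = 0 &
     forall i, (i < N)%N -> (dchar_poly B V)`_i = q i) ->
  forall PC : sign_pattern N, superpattern PB PC -> spectrally_arbitrary R PC.
Proof.
move=> BP charB onto PC PBC p pmon psize.
have [V VB DV] := fin_all_exists2 (fun j : 'I_N => onto (fun i => (i == j)%:R)).
(* Unit entries with the signs of the superpattern, at the positions where [PB] is zero. *)
pose E : 'M[R]_N :=
  \matrix_(x, y) if PB x y == SZero then (int_of_sign (PC x y))%:~R else 0.
pose W k := if unlift ord_max k is Some j then V j else E.
have WM : W ord_max = E by rewrite /W unlift_none.
have WL j : W (lift ord_max j) = V j by rewrite /W liftK.
have [G GE dG] := fin_all_exists2 (fun i : 'I_N => char_poly_affine_mpoly B W i).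
(* Multiplying a matrix by t multiplies its coefficient of index i by t^(N-i). As i < N, the added
   term vanishes at 0. *)
pose F i := G i - p`_i *: 'X_ord_max ^+ (N - i).
have F0 i : (F i).@[fun=> 0] = 0.
  rewrite mevalB GE big1 ?addr0 => [|k _]; last by rewrite scale0r.
  rewrite charB coefXn ltn_eqF // mevalZ rmorphXn /= mevalXU.
  by rewrite expr0n subn_eq0 leqNgt ltn_ord mulr0 subrr.
have dF i j : (F i)^`M(lift ord_max j).@[fun=> 0] = (i == j)%:R.
  rewrite mderivB mderivZ mderiv_exp_other ?neq_lift // scaler0 subr0 dG WL DV //.
have BSZ x y : PB x y = SZero -> B x y = 0 by move=> PB0; have := BP x y; rewrite PB0.
have [d d0 Pd] : exists2 d, 0 < d & forall xy : 'I_N * 'I_N,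
    forall z : 'I_N.+1 -> R, (forall k, `|z k| <= d) -> PB xy.1 xy.2 != SZero ->
    `|(\sum_k z k *: W k) xy.1 xy.2| < `|B xy.1 xy.2|.
  apply: finite_common_radius => [xy a a' Pa a'0 a'a z za|[x y]].
    by apply: Pa => k; apply: le_trans a'a.
  have [PB0|PB0] := eqVneq (PB x y) SZero.
    by exists 1 => // z _ /=; rewrite PB0.
  have B0 : 0 < `|B x y|.
    by rewrite normr_gt0; move: (BP x y) PB0; case: (PB x y) => //= h _;
      [rewrite gt_eqF|rewrite lt_eqF].
  set K := \sum_k `|W k x y|.
  have K0 : 0 <= K by apply: sumr_ge0.
  (* The perturbation of the entry is then at most |B_xy| K / (K + 1), too small to change its
     sign. *)
  exists (`|B x y| / (K + 1)) => [|z zd _ /=]; first by rewrite divr_gt0 // ltr_wpDl.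
  rewrite summxE; under eq_bigr do rewrite mxE mulrC.
  apply: le_lt_trans (norm_linear_le _ zd) _; rewrite -/K mulrCA gtr_pMr //.
  by rewrite ltr_pdivrMr ?ltr_wpDl // mul1r ltrDl.
have [z [t0 zd zF]] := mpoly_implicit_solution F0 dF d0.
set t := z ord_max in t0.
set M := B + \sum_k z k *: W k.
have tn0 : t != 0 by rewrite gt_eqF.
exists (t^-1 *: M) => [x y|].
  rewrite mxE; apply: has_signZ; first by rewrite invr_gt0.
  rewrite mxE; have [PB0|PB0] := eqVneq (PB x y) SZero; last first.
    by rewrite PBC //; apply: has_sign_perturb => //; exact: (Pd (x, y)).
  (* Where [PB] is zero, [B] and every [V j] vanish, so the entry is t times that of [E], and t >
     0. *)
  rewrite BSZ // add0r summxE (bigD1_ord ord_max) //= big1 ?addr0 => [|j _].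
    rewrite WM !mxE PB0 eqxx; apply: has_signZ => //.
    by case: (PC x y) => //=; rewrite ?ltr01 ?ltrN10.
  by rewrite WL mxE VB ?mulr0 // BSZ.
have coefN (q : {poly R}) : q \is monic -> size q = N.+1 -> q`_N = 1.
  by move=> /monicP; rewrite /lead_coef => <- ->.
apply/polyP => i; case: (ltngtP i N) => [ltiN|ltNi|->].
- rewrite coef_char_polyZ ?invr_eq0 // 1?ltnW //.
  have := zF (Ordinal ltiN); rewrite mevalB GE mevalZ rmorphXn /= mevalXU -/t -/M.
  move/eqP; rewrite subr_eq0 => /eqP ->.
  by rewrite mulrCA -exprMn mulVf // expr1n mulr1.
- by rewrite !nth_default ?size_char_poly ?psize.
- by rewrite !coefN ?char_poly_monic ?size_char_poly.
Qed.

(** * A nilpotent realization of the signed triangle extension *)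

Theorem theorem3p1 (R : realType) (n : nat) (PA : sign_pattern n)
    (A : 'M[R]_n) (u v : 'I_n) (PB : sign_pattern n.+1) :
  has_pattern PA A ->
  nilpotent_mx A ->
  full_rank_jacobian A ->
  u != v ->
  digraph PA u v ->
  (exists S, composite_cycle (digraph PA) n S /\ uses_arc S (u, v)) ->
  digraph PA u u ->
  (forall C, simple_cycle (digraph PA) C -> u \in cycle_vertices C ->
     (u, u) \in C \/ (u, v) \in C) ->
  \sum_(S | composite_cycle (mx_digraph A) n S && uses_arc S (u, v))
     signed_composite_weight A S != 0 ->
  signed_triangle_extension PA u v PB ->
  forall PC : sign_pattern n.+1, superpattern PB PC ->
    spectrally_arbitrary R PC.
Proof.
move=> AP [k Ak] frk uv PAuv _ PAuu cyc wgt [[_ DB BA Bww] sgnB].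
have GA : digraph PA =2 mx_digraph A.
  move=> i j; rewrite /digraph /mx_digraph; have := AP i j.
  case: (PA i j) => /= [->|A0|A0]; first by rewrite eqxx.
    by rewrite gt_eqF.
  by rewrite lt_eqF.
have simG C : simple_cycle (mx_digraph A) C -> simple_cycle (digraph PA) C.
  case/existsP=> l /existsP[p /andP[/andP[cp up] CE]].
  apply/existsP; exists l; apply/existsP; exists p; rewrite CE andbT.
  by rewrite /ucycleb up andbT (eq_cycle GA).
have Auu : A u u != 0 by have := GA u u; rewrite PAuu => /esym.
have Auv : A u v != 0 by have := GA u v; rewrite PAuv => /esym.
(* At z = 0 the cofactor of z - A is that of - A, hence the cofactor of A up to sign, and (ii) makes
   it nonzero. *)
have Q0 : (cofactor (char_poly_mx A) u v)`_0 != 0.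
  move: wgt; rewrite sum_composite_weight_cofactor; apply: contraNneq => Q0.
  have : cofactor (- A) u v = 0.
    have -> : - A = map_mx (coefp 0) (char_poly_mx A).
      apply/matrixP => i j; rewrite !mxE /= coefB coefMn coefX mul0rn coefC.
      by rewrite sub0r.
    by rewrite cofactor_map_mx.
  rewrite /cofactor -scaleN1r !linearZ /= detZ.
  by move/eqP; rewrite !mulf_eq0 !signr_eq0 /= => ->; rewrite orbT.
set w := @ord_max n; set lu := lift w u; set lv := lift w v.
(* The entry at (w, v) is taken to be 1 or -1 with the sign required by [PB]. The equation c e =
   A_uu A_uv then fixes c, and the sign condition on the extension gives c the sign of [PB] at (u,
   w). *)
pose e : R := (int_of_sign (PB w lv))%:~R.
pose c : R := A u u * A u v / e.
have PBwv : PB w lv != SZero.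
  by have := DB w lv; rewrite /digraph /triangle_ext_digraph unlift_none liftK eqxx => ->.
have e0 : e != 0 by rewrite /e intr_eq0; case: (PB w lv) PBwv.
have sge : Num.sg e = e.
  by rewrite /e; case: (PB w lv) => /=;
    rewrite ?mulr0z ?mulrN1z ?mulr1z ?sgrN ?sgr0 ?sgr1.
have ee : e * e = 1.
  by rewrite /e; case: (PB w lv) PBwv => //= _; rewrite ?mulrN1z ?mulr1z ?mulrNN mulr1.
have c0 : c != 0 by rewrite !mulf_neq0 ?invr_eq0.
have ce : c * e = A u u * A u v by rewrite divfK.
have cs : has_sign (PB lu w) c.
  have /has_signP su := AP u u; have /has_signP sv := AP u v.
  apply/has_signP; rewrite !sgrM sgrV su sv sge -intrM -sgnB intrM -mulrA.
  by rewrite -/e ee mulr1.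
have es : has_sign (PB w lv) e by apply/has_signP; rewrite sge.
pose B := triangle_ext_mx A u v c e.
have simA C : simple_cycle (mx_digraph A) C -> u \in cycle_vertices C ->
    (u, u) \in C \/ (u, v) \in C by move/simG; apply: cyc.
have BP : has_pattern PB B.
  move=> x y; have := DB x y; rewrite /digraph /triangle_ext_digraph mxE.
  case: unliftP => [i ->|->]; case: unliftP => [j ->|->].
  - rewrite -/(digraph PA i j) => Dij; case: ifP => [/eqP[iu ju]|ij].
      by move: Dij; rewrite iu ju eqxx andbF => /negbFE/eqP ->.
    rewrite ij andbT in Dij.
    have [PAij|PAij] := boolP (digraph PA i j); first by rewrite BA // ij.
    rewrite (negPf PAij) in Dij; move/negbFE/eqP: Dij => -> /=.
    by move: PAij; rewrite GA negbK => /eqP.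
  - by have [->|_] := eqVneq i u; [|move/negbFE/eqP ->].
  - by have [->|_] := eqVneq j v; [|move/negbFE/eqP ->].
  - by rewrite Bww.
apply: nilpotent_jacobian BP _ _.
  rewrite char_poly_triangle_ext_mx //; last first.
    by move=> j; apply: cofactor_off_cycle_eq0 simA => i l; rewrite negbK => /eqP.
  by rewrite ce subrr polyC0 mul0r addr0 (char_poly_nilpotent Ak) -exprS.
by move=> q; apply: triangle_ext_onto.
Qed.
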